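(* For any connected graph $\Gamma$ and any integer $n>0$, \[\mathsf{wCop}(\Gamma)\le\mathsf{wCop}(\Theta_n(\Gamma))\le n\cdot\mathsf{wCop}(\Gamma)\quad\text{and}\quad\mathsf{sCop}(\Gamma)\le\mathsf{sCop}(\Theta_n(\Gamma))\le n\cdot\mathsf{sCop}(\Gamma),\] where $\Theta_n(\Gamma)$ is the $\Theta_n$-extension of $\Gamma$ (centered at any vertex $u_0$ of $\Gamma$).
   Context: Graphs are undirected, without double edges and without loops. For a connected graph $\Gamma$, $\mathsf{dist}$ (or $\mathsf{dist}_\Gamma$) is the path distance on $V(\Gamma)$. $\Theta_n$-extension. Let $\Gamma$ be a connected graph, $u_0$ a vertex of $\Gamma$, $n$ a positive integer. Let $\Gamma_1,\dots,\Gamma_n$ be disjoint graphs with fixed isomorphisms $\eta_k\colon\Gamma\to\Gamma_k$. The $\Theta_n$-extension $\Theta_n(\Gamma)$ of $\Gamma$ centered at $u_0$ is the disjoint union $\Gamma_1\sqcup\dots\sqcup\Gamma_n$ together with, for each vertex $x$ of $\Gamma$ and each $1\le i<j\le n$, a path (called a bridge) of length $\mathsf{dist}_\Gamma(u_0,x)+1$ between $\eta_i(x)$ and $\eta_j(x)$. Formally, with $l=\mathsf{dist}_\Gamma(u_0,x)$, one adds $l$ new vertices $x^{i,j}_1,\dots,x^{i,j}_l$ and the edges $\{\eta_i(x),x^{i,j}_1\},\{x^{i,j}_1,x^{i,j}_2\},\dots,\{x^{i,j}_l,\eta_j(x)\}$ (the single edge $\{\eta_i(x),\eta_j(x)\}$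 if $l=0$); new vertices for different triples $(i,j,x)$ are distinct. Game. The cops and robber game on a connected graph $\Gamma$ has parameters: number of cops $n$, cop speed $\sigma$, cop reach $\rho$, robber speed $\psi$, a vertex $v$, and a positive integer $R$. It is a perfect information game. First the $n$ cops choose initial vertices $c^1_0,\dots,c^n_0$; then, knowing these, the robber chooses an initial vertex $r_0$. In stage $k\ge 1$ each cop moves from $c^i_{k-1}$ to a vertex $c^i_k$ with $\mathsf{dist}(c^i_{k-1},c^i_k)\le\sigma$. The robber is captured during stage $k$ if $\mathsf{dist}(r_{k-1},c^i_k)\le\rho$ for some $i$. If not captured, the robber moves from $r_{k-1}$ to a vertex $r_k$ such that there is a path from $r_{k-1}$ to $r_k$ of length at most $\psi$ all of whose vertices are at distance larger than $\rho$ from every $c^i_k$. The cops win (protect the $R$-ball centered at $v$) if the robber is captured at some stage or there is $N>0$ such that $\mathsf{dist}(v,r_k)>R$ for all $k\ge N$. $\Gamma$ is $\mathsf{CopWin}(n,\sigma,\rho,\psi,R)$ if for every vertex $v$ of $\Gamma$ the $n$ cops have a winning strategy in the game with parameters $n,\sigma,\rho,\psi,v,R$. $\Gamma$ is $n$-weak cop win if $\exists\,\sigma\in\mathbb{Z}_{>0}\ \exists\,\rho\in\mathbb{Z}_{\ge0}\ \forall\,\psi,R\in\mathbb{Z}_{>0}$: $\Gamma$ is $\mathsf{CopWin}(n,\sigma,\rho,\psi,R)$. $\Gamma$ is $n$-strong cop win if $\exists\,\sigma\in\mathbb{Z}_{>0}\ \forall\,\psi\in\mathbb{Z}_{>0}\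 \exists\,\rho\in\mathbb{Z}_{\ge0}\ \forall\,R\in\mathbb{Z}_{>0}$: $\Gamma$ is $\mathsf{CopWin}(n,\sigma,\rho,\psi,R)$. The weak cop number $\mathsf{wCop}(\Gamma)$ (resp. strong cop number $\mathsf{sCop}(\Gamma)$) in $\mathbb{Z}_{>0}\cup\{\infty\}$ is the smallest positive integer $n$ such that $\Gamma$ is $n$-weak (resp. $n$-strong) cop win, and $\infty$ if there is none. Convention: $n\cdot\infty=\infty$. *)

(* Defs.v *)
From mathcomp Require Import all_boot all_order all_algebra.
From mathcomp Require Import boolp constructive_ereal.
Set Implicit Arguments.
Unset Strict Implicit.
Unset Printing Implicit Defensive.

(* Vertex sets are arbitrary types, so graphs may be infinite. *)
Record connected_graph := ConnectedGraph {
  vertex :> Type;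
  adj : rel vertex;
  adj_sym : symmetric adj;
  adj_irr : irreflexive adj;
  adj_conn : forall x y, exists p, path adj x p /\ last x p = y }.

Section Distance.
Variable G : connected_graph.

(* A path from x to y is x :: p with path adj x p and last x p = y; its length
   is size p.  Repeated vertices are allowed: removing loops neither lengthens
   a path nor adds vertices to it. *)
Definition joined_in (x y : G) (l : nat) : Prop :=
  exists p, [/\ path (@adj G) x p, last x p = y & size p = l].

Lemma ex_joined_in x y : exists l, `[< joined_in x y l >].
Proof.
by have [p [xp lp]] := adj_conn x y; exists (size p); apply/asboolP; exists p.
Qed.

Definition dist (x y : G) : nat := ex_minn (ex_joined_in x y).

Lemma distxx x : dist x x = 0.
Proof.
rewrite /dist; case: ex_minnP => m _ /(_ 0) m_min; apply/eqP.
by rewrite -leqn0; apply: m_min; apply/asboolP; exists [::].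
Qed.

End Distance.

Section Theta.
Variables (n : nat) (G : connected_graph) (u0 : G).

(* [Copy k x] is eta_k(x); [Bridge x ltij t] is x^{i,j}_(t+1). *)
Inductive theta_vertex :=
| Copy (k : 'I_n) (x : G)
| Bridge (x : G) (i j : 'I_n) (ltij : i < j) (t : 'I_(dist u0 x)).

(* Each edge with one orientation; bridges run from copy i to copy j. *)
Inductive theta_arc : theta_vertex -> theta_vertex -> Prop :=
| arc_copy k x y : adj x y -> theta_arc (Copy k x) (Copy k y)
| arc_direct x (i j : 'I_n) :
    i < j -> dist u0 x = 0 -> theta_arc (Copy i x) (Copy j x)
| arc_first x (i j : 'I_n) (ltij : i < j) (t : 'I_(dist u0 x)) :
    t = 0 :> nat -> theta_arc (Copy i x) (Bridge ltij t)
| arc_step x (i j : 'I_n) (ltij : i < j) (s t : 'I_(dist u0 x)) :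
    t = s.+1 :> nat -> theta_arc (Bridge ltij s) (Bridge ltij t)
| arc_last x (i j : 'I_n) (ltij : i < j) (t : 'I_(dist u0 x)) :
    t.+1 = dist u0 x -> theta_arc (Bridge ltij t) (Copy j x).

Definition theta_adj : rel theta_vertex :=
  fun a b => `[< theta_arc a b \/ theta_arc b a >].

Lemma theta_adj_sym : symmetric theta_adj.
Proof. by move=> a b; apply/asbool_equiv_eq; split; case; [right|left|right|left]. Qed.

Lemma theta_adj_irr : irreflexive theta_adj.
Proof.
have arc_neq a b : theta_arc a b -> a <> b.
  case=> [k x y xy|x i j ij _|||] //.
  - by case=> exy; rewrite exy adj_irr in xy.
  - by case=> eij; rewrite eij ltnn in ij.
  - move=> x i j ij s t ts e.
    pose pos v := if v is Bridge _ _ _ _ r then nat_of_ord r else 0.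
    by have := congr1 pos e; rewrite /= ts => /n_Sn.
by move=> a; apply/asboolP; case=> /arc_neq.
Qed.

Lemma theta_adj_conn a b : exists p, path theta_adj a p /\ last a p = b.
Proof.
pose conn a b := exists p, path theta_adj a p /\ last a p = b.
have conn_trans c d e : conn c d -> conn d e -> conn c e.
  move=> [p [cp <-]] [q [dq <-]]; exists (p ++ q).
  by rewrite cat_path cp dq last_cat.
have conn1 c d : theta_adj c d -> conn c d.
  by move=> cd; exists [:: d]; rewrite /= cd.
have conn_copy k x y : conn (Copy k x) (Copy k y).
  have [p [xp <-]] := adj_conn x y; elim: p x xp => [|z p IHp] x /=.
    by exists [::].
  move=> /andP[xz zp]; apply: (conn_trans _ _ _ _ (IHp _ zp)).
  by apply: conn1; apply/asboolP; left; constructor.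
have conn_copies i j x y : conn (Copy i x) (Copy j y).
  apply: (conn_trans _ _ _ (conn_copy i x u0)).
  apply: (conn_trans _ _ _ _ (conn_copy j u0 y)).
  have [ij|ji|/val_inj->] := ltngtP i j; last by exists [::].
    by apply: conn1; apply/asboolP; left; constructor; rewrite ?distxx.
  by apply: conn1; apply/asboolP; right; constructor; rewrite ?distxx.
have conn_bridge x (i j : 'I_n) (ij : i < j) t :
    conn (Copy i x) (@Bridge x i j ij t) /\ conn (@Bridge x i j ij t) (Copy i x).
  case: t => t; elim: t => [|t IHt] lt_t.
    by split; apply: conn1; apply/asboolP; [left; constructor|right; constructor].
  have [IH1 IH2] := IHt (ltnW lt_t).
  split; [apply: (conn_trans _ _ _ IH1) | apply: (conn_trans _ _ _ _ IH2)];
    apply: conn1; apply/asboolP; [left|right]; exact: arc_step.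
case: a b => [k x|x i j ij t] [k' y|y i' j' ij' t'].
- exact: conn_copies.
- exact: (conn_trans _ _ _ (conn_copies _ _ _ _) (conn_bridge _ _ _ ij' t').1).
- exact: (conn_trans _ _ _ (conn_bridge _ _ _ ij t).2 (conn_copies _ _ _ _)).
- apply: (conn_trans _ _ _ (conn_bridge _ _ _ ij t).2).
  exact: (conn_trans _ _ _ (conn_copies _ _ _ _) (conn_bridge _ _ _ ij' t').1).
Qed.

Definition Theta : connected_graph :=
  ConnectedGraph theta_adj_sym theta_adj_irr theta_adj_conn.

End Theta.

Section Game.
Variables (G : connected_graph) (n : nat).

(* The positions of the cops as a function of the robber's positions so far:
   [c [::]] is the initial position and [c [:: r_0; ...; r_(k-1)]] the position
   chosen in stage k.  The cops' own earlier positions are determined by c, so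
   these histories carry all the information available to the cops.  The speed
   limit below is imposed on every history; this costs nothing, as the cops may
   stand still on histories that no legal play produces. *)
Definition cop_strategy := seq G -> 'I_n -> G.

Definition speed_at_most (sigma : nat) (c : cop_strategy) : Prop :=
  forall (h : seq G) (x : G) (i : 'I_n), dist (c h i) (c (rcons h x) i) <= sigma.

Definition caught (rho : nat) (C : 'I_n -> G) (x : G) : Prop :=
  exists i, dist x (C i) <= rho.

Definition robber_move (rho psi : nat) (C : 'I_n -> G) (x y : G) : Prop :=
  exists p, [/\ path (@adj G) x p, last x p = y, size p <= psi &
    all (fun w => [forall i, rho < dist w (C i)]) (x :: p)].

(* The position of the cops in stage k when the robber plays r. *)
Definition cops_at (c : cop_strategy) (r : nat -> G) (k : nat) : 'I_n -> G :=
  c (mkseq r k).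

(* Stages are numbered from 1: stage k.+1 takes the robber from r k to r k.+1.
   The values of r after a capture are unconstrained and irrelevant. *)
Definition robber_play (rho psi : nat) (c : cop_strategy) (r : nat -> G) : Prop :=
  forall k, (forall j, j <= k -> ~ caught rho (cops_at c r j.+1) (r j)) ->
    robber_move rho psi (cops_at c r k.+1) (r k) (r k.+1).

Definition cops_win (rho : nat) (v : G) (R : nat) (c : cop_strategy)
    (r : nat -> G) : Prop :=
  (exists k, caught rho (cops_at c r k.+1) (r k)) \/
  (exists2 N, 0 < N & forall k, N <= k -> R < dist v (r k)).

Definition CopWin (sigma rho psi R : nat) : Prop :=
  forall v : G, exists2 c : cop_strategy, speed_at_most sigma c &
    forall r, robber_play rho psi c r -> cops_win rho v R c r.

Definition weak_cop_win : Prop :=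
  exists2 sigma, 0 < sigma & exists rho, forall psi R,
    0 < psi -> 0 < R -> CopWin sigma rho psi R.

Definition strong_cop_win : Prop :=
  exists2 sigma, 0 < sigma & forall psi, 0 < psi -> exists rho, forall R,
    0 < R -> CopWin sigma rho psi R.

End Game.

Definition least_positive (P : nat -> Prop) : \bar int :=
  if pselect (exists n, (0 < n) && `[< P n >]) is left exP
  then (((ex_minn exP)%:Z)%:E)%E else +oo%E.

Definition wCop (G : connected_graph) : \bar int := least_positive (weak_cop_win G).

Definition sCop (G : connected_graph) : \bar int := least_positive (strong_cop_win G).

(* Main.v *)
Require Import Defs.
From mathcomp Require Import all_boot all_order all_algebra.
From mathcomp Require Import boolp constructive_ereal.
Set Implicit Arguments.
Unset Strict Implicit.
Unset Printing Implicit Defensive.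

(** The collapse of [Theta n u0] onto [G] that sends every copy of a vertex x
and every bridge over x to x does not increase distances, and neither does the
inclusion of a copy, which is a section of it.  So [G] is a retract of
[Theta n u0], and a retract is never harder to guard than the whole graph: the
cops look at the robber through the section and play the projections of their
positions ([CopWin_retract]).  This gives both lower bounds, with the same
parameters.

For the upper bounds let m cops win on [G].  On [Theta n u0] the n * m cops
play, in each copy at once, the winning strategy of the m cops against the
shadow of the robber, that is its image under the collapse.  As long as the
shadow is not captured, it moves legally in [G]: the robber can reach a new
shadow only through a copy of it, and there it is as exposed to the cops as its
shadow is.  If the shadow is never captured, then it leaves the R-ball for
good, and so does the robber since the collapse does not increase distances.
If the shadow is captured, at x say, then either the robber is in a copy, hence
is captured too, or it stands on a bridge over x both of whose ends are within
the reach of a cop.  From then on the robber cannot leave the bridge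
([line_confined]).  One of these two cops stands still while the other walks to
its end of the bridge and along the bridge ([chase_exists]), keeping the way
back closed at all times, so that the robber is eventually captured.  Speed and
reach are the same as on [G] ([CopWin_Theta]), so that the argument applies to
the weak and to the strong cop number alike. *)

(** * Distances and maps that do not increase them *)

Section Distances.
Variable G : connected_graph.
Implicit Types x y z : G.

Lemma dist_joined x y : joined_in x y (dist x y).
Proof. by rewrite /dist; case: ex_minnP => l /asboolP. Qed.

Lemma dist_min x y l : joined_in x y l -> dist x y <= l.
Proof.
by move=> xy; rewrite /dist; case: ex_minnP => d _; apply; apply/asboolP.
Qed.

Lemma dist_adj x y : adj x y -> dist x y <= 1.
Proof. by move=> xy; apply: dist_min; exists [:: y]; rewrite /= xy. Qed.

Lemma dist_le_sym x y : dist x y <= dist y x.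
Proof.
have [p [yp lp sp]] := dist_joined y x; apply: dist_min.
exists (rev (belast y p)); split; last by rewrite size_rev size_belast.
  by rewrite -lp rev_path; apply: sub_path yp => a b; rewrite adj_sym.
by case: p {yp sp} lp => [|z p] //= _; rewrite rev_cons last_rcons.
Qed.

Lemma dist_sym x y : dist x y = dist y x.
Proof. by apply/eqP; rewrite eqn_leq !dist_le_sym. Qed.

End Distances.

Definition weak_hom (G H : connected_graph) (f : G -> H) : Prop :=
  forall x y, adj x y -> f x = f y \/ adj (f x) (f y).

Section WeakHom.
Variables (G H : connected_graph) (f : G -> H).
Hypothesis f_hom : weak_hom f.

(** Edges that the map collapses are skipped, so the image may be shorter.  To
avoid the reach of the cops is the use of [Q]: it is not assumed to follow from
[P] alone, because a vertex may inherit it from the previous one when both have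
the same image. *)
Lemma weak_hom_path (P : pred G) (Q : pred H) :
    (forall x y, adj x y -> Q (f x) -> P y -> Q (f y)) ->
  forall x p, path (@adj G) x p -> all P p -> Q (f x) ->
  exists q, [/\ path (@adj H) (f x) q, last (f x) q = f (last x p),
    size q <= size p & all Q (f x :: q)].
Proof.
move=> PQ x p; elim: p x => [|y p IHp] x /=.
  by move=> _ _ Qfx; exists [::]; rewrite /= Qfx.
move=> /andP[xy yp] /andP[Py Pp] Qfx; have Qfy := PQ _ _ xy Qfx Py.
have [q [yq lq sq Qq]] := IHp y yp Pp Qfy.
have [->|fxy] := f_hom xy; first by exists q; split=> //; exact: leqW.
by exists (f y :: q); split; rewrite //= ?fxy ?Qfx.
Qed.

Lemma weak_hom_dist x y : dist (f x) (f y) <= dist x y.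
Proof.
have [p [xp lp sp]] := dist_joined x y.
have [//|//|q [xq lq sq _]] := @weak_hom_path predT predT _ x p xp (all_predT p).
by apply: leq_trans (dist_min _) (leq_trans sq _); rewrite ?sp -?lp //; exists q.
Qed.

End WeakHom.

(** * Moves of the robber under such maps *)

Lemma farP (G : connected_graph) m rho (C : 'I_m -> G) w :
  reflect (~ caught rho C w) [forall i, rho < dist w (C i)].
Proof.
apply: (iffP forallP) => [far [i]|free i]; first by rewrite leqNgt far.
by rewrite ltnNge; apply/negP => le_rho; apply: free; exists i.
Qed.

Lemma robber_move_weak_hom (G H : connected_graph) m m' rho psi (f : G -> H)
    (C : 'I_m -> G) (D : 'I_m' -> H) x y :
    weak_hom f ->
    (forall a b, adj a b -> ~ caught rho D (f a) -> ~ caught rho C b ->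
      ~ caught rho D (f b)) ->
    ~ caught rho D (f x) -> robber_move rho psi C x y ->
  robber_move rho psi D (f x) (f y).
Proof.
move=> f_hom CD /farP Dx [p [xp lp sp /= /andP[_ Cp]]].
pose far_D := [pred w | [forall i, rho < dist w (D i)]].
have [|q [xq lq sq Qq]] := weak_hom_path (Q := far_D) f_hom _ xp Cp Dx.
  by move=> a b ab /farP Da /farP Cb; apply/farP; exact: CD ab Da Cb.
by exists q; split; rewrite -?lp //; exact: leq_trans sp.
Qed.

Lemma mkseq_comp (A B : Type) (f : A -> B) (r : nat -> A) k :
  mkseq (f \o r) k = map f (mkseq r k).
Proof. exact: map_comp. Qed.

(** Captured robbers have lost already, and a robber that is never captured is
bound by the rules at every stage. *)
Lemma cops_win_uncaught (G : connected_graph) m rho psi v R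
    (c : cop_strategy G m) r :
    ((forall k, ~ caught rho (cops_at c r k.+1) (r k)) ->
     (forall k, robber_move rho psi (cops_at c r k.+1) (r k) (r k.+1)) ->
     cops_win rho v R c r) ->
  robber_play rho psi c r -> cops_win rho v R c r.
Proof.
move=> win play.
have [ex|nex] := pselect (exists k, caught rho (cops_at c r k.+1) (r k)).
  by left.
have free k : ~ caught rho (cops_at c r k.+1) (r k) by move=> ?; apply: nex; exists k.
by apply: win => // k; apply: play.
Qed.

(** The cops on the retract see the robber through the section [s] and play the
projections by [f] of the positions that the strategy on [G] would choose. *)
Lemma CopWin_retract (G H : connected_graph) m sigma rho psi R
    (f : G -> H) (s : H -> G) :
    weak_hom f -> weak_hom s -> cancel s f ->
  CopWin G m sigma rho psi R -> CopWin H m sigma rho psi R.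
Proof.
move=> f_hom s_hom sK win v; have [c c_speed c_win] := win (s v).
exists (fun h i => f (c (map s h) i)).
  move=> h x i; rewrite map_rcons.
  exact: leq_trans (weak_hom_dist f_hom _ _) (c_speed _ _ _).
have caught_f (C : 'I_m -> G) x : caught rho C (s x) -> caught rho (f \o C) x.
  move=> [i le_rho]; exists i; rewrite -{1}[x]sK.
  exact: leq_trans (weak_hom_dist f_hom _ _) le_rho.
move=> r; apply: cops_win_uncaught => free move_r.
have cops k : cops_at (fun h i => f (c (map s h) i)) r k
    = f \o cops_at c (s \o r) k.
  by rewrite /cops_at mkseq_comp.
have [|[k] Ck|[N N_gt0 out]] := c_win (s \o r).
- move=> k _; apply: robber_move_weak_hom (move_r k) => // [a b _ _ Cb sCb|sC].
    by apply: Cb; rewrite cops; exact: caught_f.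
  by apply: (free k); rewrite cops; exact: caught_f.
- by case: (free k); rewrite cops; exact: caught_f.
- right; exists N => // k /out /leq_trans; apply; exact: weak_hom_dist.
Qed.

(** * The collapse of the extension and its bridges *)

Section Extension.
Variables (n : nat) (G : connected_graph) (u0 : G).
Local Notation T := (Theta n u0).
Local Notation Copy := (@Copy n G u0).

Definition shadow (a : T) : G :=
  match a with Defs.Copy _ x => x | @Bridge _ _ _ x _ _ _ _ => x end.

(** The shadow changes only when a vertex of a copy is entered: there the cops of that copy threaten the robber as the cops of
G threaten its shadow, while inside a bridge they may be too far away. *)
Lemma shadow_adj (a b : T) : adj a b ->
  shadow a = shadow b \/ adj (shadow a) (shadow b) /\ exists k, b = Copy k (shadow b).
Proof.
move=> /asboolP[] [] /=; try by left.
  by move=> k x y xy; right; split=> //; exists k.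
by move=> k x y xy; right; split; [rewrite adj_sym | exists k].
Qed.

Lemma shadow_hom : weak_hom shadow.
Proof. by move=> a b /shadow_adj[|[]]; [left | right]. Qed.

Lemma Copy_hom k : weak_hom (Copy k : G -> T).
Proof. by move=> x y xy; right; apply/asboolP; left; constructor. Qed.

Section Line.
Variables (x : G) (i j : 'I_n) (ltij : i < j).

(** Numbering the vertices of a bridge, its ends included, turns the chase along
it into a comparison of numbers.  Staying at the far end beyond the last number
makes [line] a walk defined at all times. *)
Definition line (s : nat) : T :=
  if s is t.+1 then
    if (insub t : option 'I_(dist u0 x)) is Some t' then Bridge ltij t' else Copy j x
  else Copy i x.

Lemma line_bridge (t : 'I_(dist u0 x)) : line t.+1 = Bridge ltij t.
Proof. by rewrite /= valK. Qed.

Lemma line_end s : dist u0 x < s -> line s = Copy j x.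
Proof. by case: s => // t lt_t; rewrite /= insubF // ltnNge -ltnS lt_t. Qed.

Lemma line_step s : dist (line s) (line s.+1) <= 1.
Proof.
have [lt_s|le_s|->] := ltngtP s (dist u0 x).
- apply: dist_adj; apply/asboolP; left; rewrite (line_bridge (Ordinal lt_s)).
  case: s lt_s => [|s] lt_s; first exact: arc_first.
  by rewrite (line_bridge (Ordinal (ltnW lt_s))); exact: arc_step.
- by rewrite !line_end ?distxx // leqW.
- apply: dist_adj; apply/asboolP; left; rewrite (line_end (ltnSn _)).
  case def_l: (dist u0 x) => [|l] /=; first exact: arc_direct.
  have lt_l : l < dist u0 x by rewrite def_l.
  by rewrite insubT; exact: arc_last.
Qed.

End Line.

(** The neighbours of an inner vertex of a bridge are its neighbours on the
bridge.  The statement is split by the orientation of the edge and takes the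
vertex as a variable, which makes the dependent case analysis possible. *)
Lemma bridge_arc (a b : theta_vertex n u0) : theta_arc a b ->
  (if a is Bridge x i j ij t then b = line x ij t.+2 else True) /\
  (if b is Bridge x i j ij t then a = line x ij t else True).
Proof.
case=> //.
- by move=> x i j ij t t0; rewrite t0.
- by move=> x i j ij s t ts; rewrite -ts !line_bridge ts line_bridge.
- by move=> x i j ij t lt_l; rewrite line_end // lt_l.
Qed.

Section Confinement.
Variables (x : G) (i j : 'I_n) (ltij : i < j).
Local Notation line := (line x ltij).

Lemma line_adj s b : 0 < s <= dist u0 x -> adj (line s) b ->
  b = line s.-1 \/ b = line s.+1.
Proof.
case: s => // t lt_t /=; rewrite insubT.
by move=> /asboolP[] /bridge_arc[]; [right | left].
Qed.

Lemma line_confined k s (p : seq T) (A : pred T) :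
    k < s <= dist u0 x -> path (@adj T) (line s) p -> all A p ->
    ~~ A (line k) -> ~~ A (Copy j x) ->
  exists2 s', last (line s) p = line s' & k < s' <= dist u0 x.
Proof.
move=> lt_s sp Ap Ak Aj.
elim: p s lt_s sp Ap => [|b p IHp] s lt_s; first by exists s.
rewrite [path _ _ _]/= [last _ _]/= => /andP[sb bp] /= /andP[Ab Ap].
have /andP[lt_ks le_sl] := lt_s.
have s_gt0 : 0 < s by exact: leq_ltn_trans lt_ks.
have [|def_b|def_b] := line_adj _ sb; first by rewrite s_gt0.
  rewrite def_b in bp Ab *; apply: (IHp s.-1) => //.
  case: s s_gt0 lt_ks le_sl Ab {lt_s sb bp def_b} => //= s _.
  rewrite ltnS leq_eqVlt => /orP[/eqP <-|-> /ltnW ->] //.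
  by move=> _; rewrite (negPf Ak).
rewrite def_b in bp Ab *; apply: (IHp s.+1) => //; rewrite (leqW lt_ks) /=.
by rewrite ltnNge; apply/negP => le_ls; rewrite line_end ?ltnS // (negPf Aj) in Ab.
Qed.

(** The walk goes to the end of the bridge in copy i, then along the bridge.
Since its first part takes at most [l] steps and never is farther than [l] from
the bridge, the truncated difference [d - l] tells at every time a vertex of
the bridge within distance [l] of the walker. *)
Lemma chase_exists l (y : G) : joined_in y x l ->
  exists w : nat -> T, [/\ w 0 = Copy i y,
    forall d, dist (w d) (w d.+1) <= 1 &
    forall d, dist (line (d - l)) (w d) <= l].
Proof.
elim: l y => [|l IHl] y yx.
  have [p [_ yp /size0nil p0]] := yx; rewrite p0 /= in yp; rewrite yp.
  by exists line; split=> // [|d]; [exact: line_step | rewrite subn0 distxx].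
have [[|z p] [//= /andP[yz zp] lp [sp]]] := yx.
have [|w [w0 w_step w_near]] := IHl z; first by exists p.
exists (fun d => if d is d'.+1 then w d' else Copy i y); split=> // [] [|d].
- rewrite w0; apply: leq_trans (weak_hom_dist (Copy_hom i) _ _) _.
  exact: dist_adj.
- exact: w_step.
- rewrite dist_sym; apply: leq_trans (weak_hom_dist (Copy_hom i) _ _) _.
  exact: dist_min.
- by rewrite subSS; exact: leqW.
Qed.

Definition chase (y : G) : nat -> T :=
  projT1 (cid (chase_exists (dist_joined y x))).

Lemma chaseP (y : G) : [/\ chase y 0 = Copy i y,
  forall d, dist (chase y d) (chase y d.+1) <= 1 &
  forall d, dist (line (d - dist y x)) (chase y d) <= dist y x].
Proof. exact: projT2 (cid (chase_exists (dist_joined y x))). Qed.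

End Confinement.

(** * The strategy on the extension *)

Section Strategy.
Variables (m sigma rho : nat) (c : cop_strategy G m).
Hypothesis sigma_gt0 : 0 < sigma.
Hypothesis c_speed : speed_at_most sigma c.

Let card_pairs : #|{: 'I_n * 'I_m}| = n * m.
Proof. by rewrite card_prod !card_ord. Qed.

(** The copy that a cop works for, and the cop on G that it imitates. *)
Definition role (q : 'I_(n * m)) : 'I_n * 'I_m :=
  enum_val (cast_ord (esym card_pairs) q).

Lemma role_surj k a : exists q, role q = (k, a).
Proof.
exists (cast_ord card_pairs (enum_rank (k, a))).
by rewrite /role cast_ordK enum_rankK.
Qed.

Definition final (h : seq T) : option T :=
  if h is a :: h' then Some (last a h') else None.

Lemma final_rcons h a : final (rcons h a) = Some a.
Proof. by case: h => //= b h; rewrite last_rcons. Qed.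

Definition shadow_caught (h : seq T) : bool :=
  if final h is Some a then `[< caught rho (c (map shadow h)) (shadow a) >]
  else false.

(** A strategy only receives the history of the robber, so the time of the
first capture of the shadow is recovered by scanning this history: the first
component freezes at the capture, and the second one counts the stages since
then. *)
Definition record_stage (st : seq T * nat) (a : T) : seq T * nat :=
  if shadow_caught st.1 then (st.1, st.2.+1) else (rcons st.1 a, 0).
Definition phase (h : seq T) : seq T * nat := foldl record_stage ([::], 0) h.

(** All cops of copy i run after the robber, as those too far from the bridge to
help do no harm.  The others stay where they are, which closes the end of the
bridge in copy j. *)
Definition squeeze (h : seq T) (d : nat) (q : 'I_(n * m)) : T :=
  let y := c (map shadow h) (role q).2 in
  if final h is Some (@Bridge _ _ _ x i j ij _) then
    if shadow_caught h && ((role q).1 == i) then chase x ij y d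
    else Copy (role q).1 y
  else Copy (role q).1 y.

Definition theta_strategy : cop_strategy T (n * m) :=
  fun h => squeeze (phase h).1 (phase h).2.

Lemma squeeze_free h d q : ~~ shadow_caught h || (d == 0) ->
  squeeze h d q = Copy (role q).1 (c (map shadow h) (role q).2).
Proof.
rewrite /squeeze; case: (final h) => [[//|x i j ij t]|//].
have [caught_h /eqP->|//] := boolP (shadow_caught h); rewrite /=.
by have [->|//] := eqVneq _ i; have [-> _ _] := chaseP x ij (c (map shadow h) (role q).2).
Qed.

Lemma theta_strategy_speed : speed_at_most sigma theta_strategy.
Proof.
move=> h a q; rewrite /theta_strategy /phase foldl_rcons -/(phase h).
case: (phase h) => h0 d; rewrite /record_stage /=.
have [caught_h|free_h] := boolP (shadow_caught h0); last first.
  rewrite squeeze_free ?free_h // squeeze_free ?orbT //= map_rcons.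
  exact: leq_trans (weak_hom_dist (Copy_hom _) _ _) (c_speed _ _ _).
rewrite /= /squeeze caught_h /=; case: (final h0) => [[k x|x i j ij t]|].
- by rewrite distxx.
- case: ifP => _; last by rewrite distxx.
  have [_ step _] := chaseP x ij (c (map shadow h0) (role q).2).
  exact: leq_trans (step d) sigma_gt0.
- by rewrite distxx.
Qed.

Variables (psi : nat) (r : nat -> T).
Local Notation cops k := (cops_at theta_strategy r k).
Local Notation shadow_cops k := (cops_at c (shadow \o r) k).

Lemma shadow_caught_mkseq k :
  shadow_caught (mkseq r k.+1) =
    `[< caught rho (shadow_cops k.+1) (shadow (r k)) >].
Proof. by rewrite /shadow_caught /cops_at mkseq_comp mkseqS final_rcons. Qed.

Lemma phase_mkseqS k : phase (mkseq r k.+1) = record_stage (phase (mkseq r k)) (r k).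
Proof. by rewrite mkseqS /phase foldl_rcons. Qed.

Lemma phase_free k :
    (forall j, j < k -> ~ caught rho (shadow_cops j.+1) (shadow (r j))) ->
  phase (mkseq r k.+1) = (mkseq r k.+1, 0).
Proof.
move=> free; elim: k free => [|k IHk] free; first by [].
rewrite phase_mkseqS IHk => [|j /leqW]; last exact: free.
rewrite /record_stage shadow_caught_mkseq asboolF; last exact: free.
by rewrite -mkseqS.
Qed.

Lemma phase_caught k d :
    (forall j, j < k -> ~ caught rho (shadow_cops j.+1) (shadow (r j))) ->
    caught rho (shadow_cops k.+1) (shadow (r k)) ->
  phase (mkseq r (k + d).+1) = (mkseq r k.+1, d).
Proof.
move=> free caught_k; elim: d => [|d IHd]; first by rewrite addn0; exact: phase_free.
by rewrite addnS phase_mkseqS IHd /record_stage shadow_caught_mkseq asboolT.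
Qed.

(** The inclusion of copy k does not increase distances, and each of the m cops
is imitated by one that works for this copy. *)
Lemma caught_copy (C : 'I_m -> G) (D : 'I_(n * m) -> T) k x :
    (forall q, (role q).1 = k -> D q = Copy k (C (role q).2)) ->
  caught rho C x -> caught rho D (Copy k x).
Proof.
move=> CD [a le_rho]; have [q def_q] := role_surj k a; exists q.
rewrite CD ?def_q //.
exact: leq_trans (weak_hom_dist (Copy_hom k) _ _) le_rho.
Qed.

Hypothesis robber_free : forall k, ~ caught rho (cops k.+1) (r k).
Hypothesis robber_moves : forall k, robber_move rho psi (cops k.+1) (r k) (r k.+1).

Lemma shadow_move k :
    (forall j, j <= k -> ~ caught rho (shadow_cops j.+1) (shadow (r j))) ->
  robber_move rho psi (shadow_cops k.+1) (shadow (r k)) (shadow (r k.+1)).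
Proof.
move=> free.
have cops_k q : cops k.+1 q = Copy (role q).1 (shadow_cops k.+1 (role q).2).
  rewrite /cops_at /theta_strategy phase_free => [|j /ltnW]; last exact: free.
  by rewrite squeeze_free ?orbT // /cops_at mkseq_comp.
apply: robber_move_weak_hom (robber_moves k); [exact: shadow_hom | | exact: free].
move=> a b /shadow_adj[-> //|[_ [j def_b]]] _ free_b; rewrite def_b /=.
apply: contra_not free_b; rewrite def_b /=; apply: caught_copy => q <-.
exact: cops_k.
Qed.

(** Once the shadow is captured, the robber is between a cop that stands still
near one end of the bridge and one that advances from the other end. *)
Lemma shadow_free k : ~ caught rho (shadow_cops k.+1) (shadow (r k)).
Proof.
move=> caught_k.
have ex : exists k, `[< caught rho (shadow_cops k.+1) (shadow (r k)) >].
  by exists k; apply/asboolP.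
case: (ex_minnP ex) => k0 /asboolP caught_k0 k0_min {ex k caught_k}.
have free j : j < k0 -> ~ caught rho (shadow_cops j.+1) (shadow (r j)).
  by move=> lt_j /asboolP/k0_min; rewrite leqNgt lt_j.
have cops_d d : cops (k0 + d).+1 = squeeze (mkseq r k0.+1) d.
  by rewrite /cops_at /theta_strategy (phase_caught d free caught_k0).
set h := mkseq r k0.+1 in cops_d.
have final_h : final h = Some (r k0) by rewrite /h mkseqS final_rcons.
have caught_h : shadow_caught h by rewrite shadow_caught_mkseq; apply/asboolP.
have shadow_h : map shadow h = mkseq (shadow \o r) k0.+1 by rewrite mkseq_comp.
case def_r: (r k0) => [k x|x i j ij t].
  case: (robber_free (k := k0)); rewrite def_r -[k0 in cops k0.+1]addn0 cops_d.
  apply: (@caught_copy (shadow_cops k0.+1)) => [q <-|].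
    by rewrite squeeze_free ?orbT ?shadow_h.
  by rewrite def_r in caught_k0.
have [a] := caught_k0; rewrite def_r /=; set y := shadow_cops k0.+1 a => near.
have [_ _ chase_near] := chaseP x ij y.
have near_i d : exists q, dist (line x ij (d - dist y x)) (squeeze h d q) <= rho.
  have [q def_q] := role_surj i a; exists q.
  rewrite /squeeze final_h def_r caught_h def_q eqxx shadow_h /= -/y.
  by apply: leq_trans (chase_near d) _; rewrite dist_sym.
have near_j d : exists q, dist (Copy j x : T) (squeeze h d q) <= rho.
  have [q def_q] := role_surj j a; exists q.
  have neq_ji : (j == i) = false by apply: contraTF (ij) => /eqP->; rewrite ltnn.
  rewrite /squeeze final_h def_r caught_h def_q neq_ji shadow_h /= -/y.
  exact: leq_trans (weak_hom_dist (Copy_hom j) _ _) near.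
(* [line (d - dist y x)] is within reach of the advancing cop.  The inequality is
   large before the robber moves; that the robber is uncaught makes it strict. *)
have ahead d : exists2 s, r (k0 + d) = line x ij s &
    (0 < s <= dist u0 x) && (d - dist y x <= s).
  elim: d => [|d [s def_s /andP[/andP[s_gt0 le_sl] le_ds]]].
    (* [line] counts the end of the bridge, hence the shift of t *)
    exists t.+1; first by rewrite addn0 line_bridge.
    by rewrite ltn_ord.
  have [p [sp lp _ /= /andP[As Ap]]] := robber_moves (k0 + d).
  rewrite def_s cops_d in sp lp As Ap.
  have [q near_q] := near_i d; have [q' near_q'] := near_j d.
  have lt_ds : d - dist y x < s.
    rewrite ltn_neqAle le_ds andbT; apply/eqP => eq_ds.
    by move/forallP/(_ q): As; rewrite -eq_ds ltnNge near_q.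
  have [|||s' def_s' /andP[lt_ds' le_s'l]] :=
      line_confined (k := d - dist y x) _ sp Ap.
  - by rewrite lt_ds.
  - by apply/forallPn; exists q; rewrite -leqNgt.
  - by apply/forallPn; exists q'; rewrite -leqNgt.
  exists s'; first by rewrite addnS -lp.
  rewrite le_s'l (leq_ltn_trans _ lt_ds') //=.
  by apply: leq_trans lt_ds'; rewrite leq_subLR addnS ltnS -leq_subLR.
have [s _ /andP[/andP[_ le_sl] le_s]] := ahead (dist y x + (dist u0 x).+1).
by move: (leq_trans le_s le_sl); rewrite addKn ltnn.
Qed.

End Strategy.

Lemma CopWin_Theta m sigma rho psi R : 0 < sigma ->
  CopWin G m sigma rho psi R -> CopWin T (n * m) sigma rho psi R.
Proof.
move=> sigma_gt0 win v; have [c c_speed c_win] := win (shadow v).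
exists (theta_strategy rho c); first exact: theta_strategy_speed.
move=> r; apply: cops_win_uncaught => free moves.
have [||[N N_gt0 out]] := c_win (shadow \o r).
- by move=> k; exact: (shadow_move moves).
- by move=> [k] /(shadow_free free moves).
- right; exists N => // k /out /leq_trans; apply; exact: weak_hom_dist shadow_hom _ _.
Qed.

Lemma CopWin_base m sigma rho psi R : 0 < n ->
  CopWin T m sigma rho psi R -> CopWin G m sigma rho psi R.
Proof.
move=> n_gt0; apply: (CopWin_retract shadow_hom (Copy_hom (Ordinal n_gt0))).
by [].
Qed.

End Extension.

(** * Cop numbers *)

Lemma least_positive_le (P : nat -> Prop) m :
  0 < m -> P m -> (least_positive P <= (m%:Z)%:E)%E.
Proof.
move=> m_gt0 Pm; rewrite /least_positive; case: pselect => [exP|[]].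
  by case: ex_minnP => k _ /(_ m); rewrite lee_fin lez_nat m_gt0 => -> //; apply/asboolP.
by exists m; rewrite m_gt0; apply/asboolP.
Qed.

Lemma least_positiveP (P : nat -> Prop) :
  least_positive P = +oo%E \/
  exists m, [/\ 0 < m, P m & least_positive P = ((m%:Z)%:E)%E].
Proof.
rewrite /least_positive; case: pselect => [exP|]; last by left.
by right; case: ex_minnP => m /andP[m_gt0 /asboolP Pm] _; exists m.
Qed.

Lemma least_positive_sub (P Q : nat -> Prop) :
  (forall m, P m -> Q m) -> (least_positive Q <= least_positive P)%E.
Proof.
move=> PQ; have [->|[m [m_gt0 Pm ->]]] := least_positiveP P; first exact: leey.
by apply: least_positive_le => //; exact: PQ.
Qed.

Lemma least_positive_mul n (P Q : nat -> Prop) :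
    0 < n -> (forall m, P m -> Q (n * m)) ->
  (least_positive Q <= (n%:Z)%:E * least_positive P)%E.
Proof.
move=> n_gt0 PQ; have [->|[m [m_gt0 Pm ->]]] := least_positiveP P.
  by rewrite gt0_muley ?leey // lte_fin ltz_nat.
rewrite -EFinM -PoszM; apply: least_positive_le; first by rewrite muln_gt0 n_gt0.
exact: PQ.
Qed.

(** The hypothesis is uniform in the parameters, so that it passes through the
quantifiers of both notions. *)
Lemma cop_win_transfer (G H : connected_graph) m m' :
    (forall sigma rho psi R, 0 < sigma ->
      CopWin G m sigma rho psi R -> CopWin H m' sigma rho psi R) ->
  (weak_cop_win G m -> weak_cop_win H m') /\
  (strong_cop_win G m -> strong_cop_win H m').
Proof.
move=> GH; split=> [] [sigma sigma_gt0 win]; exists sigma => //.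
  have [rho {}win] := win; exists rho => psi R psi_gt0 R_gt0.
  by apply: GH => //; exact: win.
move=> psi psi_gt0; have [rho {}win] := win psi psi_gt0; exists rho => R R_gt0.
by apply: GH => //; exact: win.
Qed.

Theorem theorem13 (G : connected_graph) (n : nat) (n_gt0 : (0 < n)%N) (u0 : G) :
  ((wCop G <= wCop (Theta n u0))%E /\
   (wCop (Theta n u0) <= (n%:Z)%:E * wCop G)%E) /\
  ((sCop G <= sCop (Theta n u0))%E /\
   (sCop (Theta n u0) <= (n%:Z)%:E * sCop G)%E).
Proof.
have lower m := cop_win_transfer (fun sigma rho psi R (_ : 0 < sigma) =>
  @CopWin_base n G u0 m sigma rho psi R n_gt0).
have upper m := cop_win_transfer (@CopWin_Theta n G u0 m).
split; split.
- by apply: least_positive_sub => m; exact: (lower m).1.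
- by apply: least_positive_mul => // m; exact: (upper m).1.
- by apply: least_positive_sub => m; exact: (lower m).2.
- by apply: least_positive_mul => // m; exact: (upper m).2.
Qed.
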